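(* Let $F$ be a field of characteristic $2$ such that every element of $F$ is a square, let $n\ge 2$, and let $X$ be a symmetric $n\times n$ matrix over $F$. Then: (a) $X$ is $U$-congruent to a unique specialized pseudo-permutation matrix. (b) $X$ is $B$-congruent to a unique specialized pseudo-permutation $(0,1)$-matrix.
   Context: $M$ is the space of all $n\times n$ matrices over $F$, and $X'$ denotes the transpose of $X$. $B$ is the group of all invertible upper triangular $n\times n$ matrices over $F$, and $U$ is the group of all upper triangular $n\times n$ matrices over $F$ whose diagonal entries are all equal to $1$. For a subgroup $H$ of $\mathrm{GL}_n(F)$, matrices $X,Y\in M$ are $H$-congruent if there is $h\in H$ with $h'Xh=Y$. A $(0,1)$-matrix is a matrix all of whose entries are $0$ or $1$. A matrix $X\in M$ is a pseudo-permutation if $X$ is symmetric, every column of $X$ has at most two non-zero entries, and whenever column $j$ of $X$ has two non-zero entries, these are $X_{jj}$ and $X_{ij}$ for some $i<j$. Let $X$ be a pseudo-permutation. An $X$-pair is a pair $(i,j)$ with $i<j$ such that $X_{ij}$ and $X_{jj}$ are both non-zero (in this case $X_{ii}=0$). If $(i,j)$ and $(k,\ell)$ are $X$-pairs, then $(k,\ell)$ is inside $(i,j)$ if $i<k<\ell<j$. An $X$-index is an index $s$ such that $X_{ss}\neq 0$ and this is the only non-zero entry in column $s$ of $X$. An $X$-index $s$ is $X$-interior to the $X$-pair $(i,j)$ if $i<s<j$. An $X$-pair is problematic if it has an $X$-pair inside it or an $X$-index interior to it. $X$ is a specialized pseudo-permutation if it is a pseudo-permutation with no problematic $X$-pairs.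 *)

(* Defs.v *)
From mathcomp Require Import all_boot all_order all_algebra.
Set Implicit Arguments.
Unset Strict Implicit.
Unset Printing Implicit Defensive.
Import GRing.Theory.
Local Open Scope ring_scope.

(* [is_trig_mx] is the lower triangular predicate, whence the transpose. *)
Definition borel (F : fieldType) (n : nat) : {pred 'M[F]_n} :=
  fun A => is_trig_mx A^T && (A \in unitmx).

Definition unitriangular (F : fieldType) (n : nat) : {pred 'M[F]_n} :=
  fun A => is_trig_mx A^T && [forall i, A i i == 1].

Definition congruent (F : fieldType) (n : nat) (H : {pred 'M[F]_n})
    (X Y : 'M[F]_n) : Prop :=
  exists2 h : 'M[F]_n, h \in H & h^T *m X *m h = Y.

Definition zero_one_mx (F : fieldType) (n : nat) (X : 'M[F]_n) : Prop :=
  forall i j, X i j = 0 \/ X i j = 1.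

Definition col_support (F : fieldType) (n : nat) (X : 'M[F]_n) (j : 'I_n) :
  {set 'I_n} := [set i | X i j != 0].

Definition pseudo_permutation (F : fieldType) (n : nat) (X : 'M[F]_n) : Prop :=
  [/\ X^T = X,
      forall j, (#|col_support X j| <= 2)%N
    & forall j, #|col_support X j| = 2%N ->
        exists2 i : 'I_n, (i < j)%N & col_support X j = [set j; i]].

Definition X_pair (F : fieldType) (n : nat) (X : 'M[F]_n)
    (p : 'I_n * 'I_n) : Prop :=
  [/\ (p.1 < p.2)%N, X p.1 p.2 != 0 & X p.2 p.2 != 0].

Definition inside (n : nat) (q p : 'I_n * 'I_n) : Prop :=
  [/\ (p.1 < q.1)%N, (q.1 < q.2)%N & (q.2 < p.2)%N].

Definition X_index (F : fieldType) (n : nat) (X : 'M[F]_n) (s : 'I_n) : Prop :=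
  X s s != 0 /\ (forall i, X i s != 0 -> i = s).

Definition interior (n : nat) (s : 'I_n) (p : 'I_n * 'I_n) : Prop :=
  (p.1 < s < p.2)%N.

Definition problematic (F : fieldType) (n : nat) (X : 'M[F]_n)
    (p : 'I_n * 'I_n) : Prop :=
  (exists2 q, X_pair X q & inside q p) \/
  (exists2 s, X_index X s & interior s p).

Definition specialized (F : fieldType) (n : nat) (X : 'M[F]_n) : Prop :=
  pseudo_permutation X /\ (forall p, X_pair X p -> ~ problematic X p).

(* Main.v *)
(* Existence: reduce row by row.  Let m be the first unused index with a non-zero
   row.  If X m m != 0, it clears the rest of row m.  Otherwise let j be the first
   index with X m j != 0: column j clears row m, then column m clears row j, and
   only the entry X j j survives.  If some unused s in (m, j) has X s s != 0, adding
   a multiple (a square root) of column s to column j beforehand kills X j j, so the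
   pair (m, j) is never problematic.  This last property is stable, since
   (h^T X h) i i is the sum of the X k k * (h k i)^2 in characteristic 2.

   Uniqueness: let h^T X h = Y with h upper triangular and X, Y specialized.  Read as
   X h = h^-T Y, a row-by-row comparison shows that outside the second diagonal
   entries of pairs Y i j = h i i * h j j * X i j.  For a pair (a, b), column b of
   X h vanishes above row a, and as no pair is problematic this forces h i b = 0
   for all i < b with X i i != 0, whence Y b b = (h b b)^2 * X b b. *)

Require Import Defs.
From mathcomp Require Import all_boot all_order all_algebra.
From mathcomp Require Import ring.
Set Implicit Arguments.
Unset Strict Implicit.
Unset Printing Implicit Defensive.
Import GRing.Theory.
Local Open Scope ring_scope.

(** * Entrywise criteria for pseudo-permutations and specialized matrices *)

Section Specialized.
Variables (F : fieldType) (n : nat).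
Implicit Types X Y : 'M[F]_n.

(** A pairwise condition replaces the cardinal bounds: among three distinct non-zero rows, some two
    would both avoid [j], so at most two entries survive. *)
Definition sparse_col X (j : 'I_n) : Prop :=
  forall i k, X i j != 0 -> X k j != 0 -> i != k ->
    ((i < j)%N /\ k = j) \/ ((k < j)%N /\ i = j).

Lemma sym_mxE X : X^T = X -> forall i j, X i j = X j i.
Proof. by move=> XT i j; rewrite -[in LHS]XT mxE. Qed.

Lemma pseudo_permutationP X :
  pseudo_permutation X <-> X^T = X /\ forall j, sparse_col X j.
Proof.
split=> [[XT le2 eq2]|[XT sp]].
  split=> // j i k Xi Xk ik.
  have /eqP c2 : #|col_support X j| == 2%N.
    rewrite eqn_leq le2 /=; apply: (@leq_trans #|[set i; k]|).
      by rewrite cards2 ik.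
    by apply/subset_leq_card/subsetP=> x; rewrite !inE => /orP[]/eqP->.
  have [l lj sE] := eq2 j c2.
  have: i \in col_support X j by rewrite inE.
  have: k \in col_support X j by rewrite inE.
  rewrite sE !inE => /orP[]/eqP ek /orP[]/eqP ei; subst; rewrite ?eqxx // in ik.
    by left.
  by right.
have supp2 j i k : X i j != 0 -> X k j != 0 -> i != k ->
    exists2 l : 'I_n, (l < j)%N & col_support X j = [set j; l].
  move=> Xi Xk ik.
  wlog [ij kj] : i k Xi Xk ik / (i < j)%N /\ k = j.
    move=> W; have [H|H] := sp j i k Xi Xk ik; first exact: (W i k).
    by apply: (W k i) => //; rewrite eq_sym.
  subst k; exists i => //; apply/setP=> x; rewrite !inE.
  apply/idP/orP=> [Xx|[]/eqP->//].
  have [/eqP|xj] := eqVneq x j; first by left.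
  have [/eqP|xi] := eqVneq x i; first by right.
  have [[_ e]|[_ e]] := sp j x i Xx Xi xi; first by rewrite e ltnn in ij.
  by rewrite e eqxx in xj.
split=> // j.
  rewrite leqNgt; apply/negP=> c3.
  have /card_gt1P [i [k [Xi Xk ik]]] : (1 < #|col_support X j|)%N by exact: ltnW.
  rewrite !inE in Xi Xk; have [l _ sE] := supp2 j i k Xi Xk ik.
  by move: c3; rewrite sE cards2; case: eqP.
move=> c2.
have /card_gt1P [i [k [Xi Xk ik]]] : (1 < #|col_support X j|)%N by rewrite c2.
by rewrite !inE in Xi Xk; exact: supp2 Xi Xk ik.
Qed.

(** The mirror entry [X j i] lies below the diagonal of column [i], where it tolerates no second
    non-zero entry. *)
Lemma sparse_row X (i j k : 'I_n) : X^T = X -> (forall j, sparse_col X j) ->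
  (i < j)%N -> X i j != 0 -> X i k != 0 -> k = j.
Proof.
move=> XT sp ij Xij Xik; apply/eqP/negPn/negP=> kj.
have Xji : X j i != 0 by rewrite sym_mxE.
have Xki : X k i != 0 by rewrite sym_mxE.
have [[_ e]|[l _]] := sp i k j Xki Xji kj; first by rewrite e ltnn in ij.
by rewrite ltnNge ltnW in l.
Qed.

(* In a pseudo-permutation such a [k] makes [(k, s)] a pair starting before [a]. *)
Definition pivots_outside X : Prop :=
  forall a b s : 'I_n, X a b != 0 -> X b b != 0 -> X s s != 0 ->
    (a < s)%N -> (s < b)%N -> exists2 k : 'I_n, (k < a)%N & X k s != 0.

(** An index [s] with [X s s != 0] is either an index of [X] or the end of a pair [(k, s)]. Between
    [a] and [b] the first is problematic, and so is the second unless [k < a]; [k = a] is impossible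
    because row [a] has its only entry in column [b]. *)
Lemma specializedP X :
  specialized X <->
  [/\ X^T = X, forall j, sparse_col X j & pivots_outside X].
Proof.
split=> [[/pseudo_permutationP[XT sp] np]|[XT sp out]].
  split=> // a b s Xab Xbb Xss as_ sb.
  have pab : X_pair X (a, b) by split=> //; apply: ltn_trans sb.
  have [/existsP[k /andP[ks Xks]]|noabove] :=
    boolP [exists k : 'I_n, (k < s)%N && (X k s != 0)].
    have [ka|ak|/val_inj ka] := ltngtP k a; first by exists k.
      by case: (np _ pab); left; exists (k, s); split.
    subst k; have e := sparse_row XT sp as_ Xks Xab.
    by rewrite e ltnn in sb.
  case: (np _ pab); right; exists s; last by rewrite /interior as_.
  split=> // i Xis; apply/eqP/negPn/negP=> ins.
  have [[is_ _]|[]] := sp s i s Xis Xss ins; last by rewrite ltnn.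
  by case/negP: noabove; apply/existsP; exists i; rewrite is_.
split; first exact/pseudo_permutationP.
move=> [a b] [/= ab Xab Xbb] [[[k l] [/= kl Xkl Xll]] [/= ak _ lb]|[s [Xss sI]]].
  have [k' k'a Xk'l] := out a b l Xab Xbb Xll (ltn_trans ak kl) lb.
  have k'k : k' != k by apply: contraTneq (ltn_trans k'a ak) => ->; rewrite ltnn.
  have [[_ e]|[_ e]] := sp l k' k Xk'l Xkl k'k; first by rewrite e ltnn in kl.
  by have := ltn_trans (ltn_trans k'a ak) kl; rewrite e ltnn.
rewrite /interior /= => /andP[as_ sb].
have [k ka Xks] := out a b s Xab Xbb Xss as_ sb.
by have := ltn_trans ka as_; rewrite (sI k Xks) ltnn.
Qed.

End Specialized.

Lemma tr_congruence (R : comPzRingType) n (X h : 'M[R]_n) :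
  X^T = X -> (h^T *m X *m h)^T = h^T *m X *m h.
Proof. by move=> XT; rewrite !trmx_mul trmxK XT mulmxA. Qed.

(** * The upper triangular groups and congruence under them *)

Section UpperTriangular.
Variables (F : fieldType) (n : nat).
Implicit Types (h g : 'M[F]_n).

Definition upper h : Prop := forall i j : 'I_n, (j < i)%N -> h i j = 0.

Lemma upperP h : reflect (upper h) (is_trig_mx h^T).
Proof.
by apply: (iffP is_trig_mxP) => H i j /(H _); rewrite mxE.
Qed.

Lemma upperM h g : upper h -> upper g -> upper (h *m g).
Proof.
move=> uh ug i j ji; rewrite mxE big1 // => k _.
have [ki|ik] := ltnP k i; first by rewrite uh ?mul0r.
by rewrite ug ?mulr0 //; apply: leq_trans ik.
Qed.

Lemma upperM_diag h g i : upper h -> upper g ->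
  (h *m g) i i = h i i * g i i.
Proof.
move=> uh ug; rewrite mxE (bigD1 i) //= big1 ?addr0 // => k ki.
have [lki|ik] := ltnP k i; first by rewrite uh ?mul0r.
by rewrite ug ?mulr0 // ltn_neqAle eq_sym ki.
Qed.

Lemma upper_unitmx h : upper h ->
  (h \in unitmx) = [forall i, h i i != 0].
Proof.
move=> /upperP uh; rewrite -unitmx_tr unitmxE det_trig // unitfE.
apply/prodf_neq0/forallP=> H i; first by have := H i isT; rewrite mxE.
by rewrite mxE.
Qed.

(** Strong induction on the column: in entry [(i, j)] of [invmx h *m h = 1] only
    [invmx h i j * h j j] remains, and [h j j] is non-zero. *)
Lemma upperV h : h \in unitmx -> upper h -> upper (invmx h).
Proof.
move=> hu uh i j; have [m] := ubnP (j : nat).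
elim: m j => // m IH j jm ji; have := mulVmx hu => /matrixP/(_ i j).
rewrite !mxE (bigD1 j) //= big1 => [|k kj].
  rewrite addr0 -val_eqE gtn_eqF //= => /eqP; rewrite mulf_eq0 => /orP[/eqP//|/eqP hj].
  by move: hu; rewrite upper_unitmx // => /forallP/(_ j); rewrite hj eqxx.
have [lkj|jk] := ltnP k j.
  by rewrite IH ?mul0r //; [exact: leq_trans lkj jm | exact: ltn_trans ji].
by rewrite uh ?mulr0 // ltn_neqAle eq_sym kj.
Qed.

Lemma borelP h :
  reflect (upper h /\ forall i, h i i != 0) (h \in @borel F n).
Proof.
rewrite unfold_in; apply: (iffP andP) => -[/upperP uh].
  by rewrite upper_unitmx // => /forallP.
by split=> //; rewrite upper_unitmx; [exact/forallP | exact/upperP].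
Qed.

Lemma unitriangularP h :
  reflect (upper h /\ forall i, h i i = 1) (h \in @unitriangular F n).
Proof.
rewrite unfold_in; apply: (iffP andP) => -[/upperP uh].
  by move/forallP=> H; split=> // i; exact/eqP.
by move=> H; split=> //; apply/forallP=> i; exact/eqP.
Qed.

Lemma unitriangularM h g : h \in @unitriangular F n ->
  g \in @unitriangular F n -> h *m g \in @unitriangular F n.
Proof.
move=> /unitriangularP[uh dh] /unitriangularP[ug dg]; apply/unitriangularP.
by split=> [|i]; [exact: upperM | rewrite upperM_diag // dh dg mulr1].
Qed.

Lemma borelM h g : h \in @borel F n -> g \in @borel F n -> h *m g \in @borel F n.
Proof.
move=> /borelP[uh dh] /borelP[ug dg]; apply/borelP.
by split=> [|i]; [exact: upperM | rewrite upperM_diag // mulf_neq0].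
Qed.

Lemma borelV h : h \in @borel F n -> invmx h \in @borel F n.
Proof.
move=> hB; have /andP[/upperP uh hu] := hB.
by apply/andP; rewrite unitmx_inv; split=> //; apply/upperP/upperV.
Qed.

Lemma unitriangular_borel h : h \in @unitriangular F n -> h \in @borel F n.
Proof.
move=> /unitriangularP[uh dh]; apply/borelP; split=> // i.
by rewrite dh oner_neq0.
Qed.

Lemma unitriangularV h : h \in @unitriangular F n ->
  invmx h \in @unitriangular F n.
Proof.
move=> hU; have hB := unitriangular_borel hU.
have /unitriangularP[uh dh] := hU; have /borelP[uV _] := borelV hB.
have /andP[_ hu] := hB.
apply/unitriangularP; split=> // i; have := mulVmx hu => /matrixP/(_ i i).
by rewrite upperM_diag // dh mulr1 mxE eqxx.
Qed.

Lemma congruentU_refl X : congruent (@unitriangular F n) X X.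
Proof.
exists 1%:M; last by rewrite trmx1 mul1mx mulmx1.
apply/unitriangularP; split=> [i j ji|i]; rewrite mxE ?eqxx //.
by rewrite -val_eqE gtn_eqF.
Qed.

Lemma congruent_trans (H : {pred 'M[F]_n}) X Y Z :
  (forall h g, h \in H -> g \in H -> h *m g \in H) ->
  congruent H X Y -> congruent H Y Z -> congruent H X Z.
Proof.
move=> HM [h hH <-] [g gH <-]; exists (h *m g); first exact: HM.
by rewrite trmx_mul !mulmxA.
Qed.

Lemma congruent_sym (H : {pred 'M[F]_n}) X Y :
  (forall h, h \in H -> h \in unitmx) ->
  (forall h, h \in H -> invmx h \in H) ->
  congruent H X Y -> congruent H Y X.
Proof.
move=> Hu HV [h hH <-]; exists (invmx h); first exact: HV.
have hu := Hu _ hH.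
by rewrite trmx_inv !mulmxA mulVmx ?unitmx_tr // mul1mx mulmxK.
Qed.

End UpperTriangular.

(** * Uniqueness: congruent specialized matrices differ by a diagonal scaling *)

Section Uniqueness.
Variables (F : fieldType) (n : nat).
Implicit Types X Y h : 'M[F]_n.

(** Forward substitution: as [h^T] is lower triangular, zeros at the top of column [j] of [C] force
    the same zeros in [A], and row [i] keeps only its diagonal term. *)
Lemma upper_solve h (A C : 'M[F]_n) (i j : 'I_n) : upper h -> (forall i, h i i != 0) ->
  h^T *m A = C -> (forall l : 'I_n, (l < i)%N -> C l j = 0) ->
  C i j = h i i * A i j.
Proof.
move=> uh dh <-; have [m] := ubnP (i : nat); elim: m i => // m IH i im C0.
rewrite mxE (bigD1 i) //= mxE big1 ?addr0 // => l li; rewrite mxE.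
have [ltli|il] := ltnP l i; last first.
  by rewrite uh ?mul0r // ltn_neqAle eq_sym li.
have /esym/eqP := IH l (leq_trans ltli im) (fun k kl => C0 k (ltn_trans kl ltli)).
by rewrite C0 // mulf_eq0 (negbTE (dh l)) => /eqP->; rewrite mulr0.
Qed.

Section CongruentSparse.
Variables X Y h : 'M[F]_n.
Hypotheses (XT : X^T = X) (YT : Y^T = Y).
Hypotheses (spX : forall j, sparse_col X j) (spY : forall j, sparse_col Y j).
Hypotheses (uh : upper h) (dh : forall i, h i i != 0).
Hypothesis hXY : h^T *m X *m h = Y.

Let hXY' : h^T *m (X *m h) = Y.
Proof. by rewrite mulmxA. Qed.

Let hh_neq0 i j a : (h i i * h j j * a == 0) = (a == 0).
Proof. by rewrite !mulf_eq0 !(negbTE (dh _)). Qed.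

(** Induction on the row, through [upper_solve]. The second hypothesis sets aside diagonal entries
    with a non-zero entry above them, where [upper_solve] does not isolate row [i]. *)
Lemma scaled_offpair (i j : 'I_n) : (i <= j)%N ->
  (i = j -> forall k : 'I_n, (k < i)%N -> X k i = 0) ->
  Y i j = h i i * h j j * X i j.
Proof.
have [m] := ubnP (i : nat); elim: m i j => // m IH i j im ij core.
have IHl (l k : 'I_n) : (l < i)%N -> (l < k)%N -> Y l k = h l l * h k k * X l k.
  move=> li lk; apply: IH => //; first exact: leq_trans li im.
    exact: ltnW.
  by move=> e; rewrite e ltnn in lk.
(* Above row [i], column [j] vanishes in both matrices as soon as it does in one. *)
have half (k : 'I_n) : (i <= k)%N ->
    (i = k -> forall l : 'I_n, (l < i)%N -> X l i = 0) ->
  (forall l : 'I_n, (l < i)%N -> X l k = 0) ->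
  (forall l : 'I_n, (l < k)%N -> X i l = 0) ->
  Y i k = h i i * h k k * X i k.
  move=> ik corek X0 Xi0; rewrite (upper_solve uh dh hXY').
    rewrite mxE (bigD1 k) //= big1 ?addr0; first by rewrite -mulrA [h k k * _]mulrC.
    move=> l lk; have [ltlk|kl] := ltnP l k; first by rewrite Xi0 ?mul0r.
    by rewrite uh ?mulr0 // ltn_neqAle eq_sym lk.
  by move=> l li; rewrite IHl ?X0 ?mulr0 //; apply: leq_trans ik.
have fromX (k : 'I_n) : (i <= k)%N ->
    (i = k -> forall l : 'I_n, (l < i)%N -> X l i = 0) ->
  X i k != 0 -> Y i k = h i i * h k k * X i k.
  move=> ik corek Xik.
  have Xl0 (l : 'I_n) : (l < i)%N -> X l k = 0.
    move=> li; apply/eqP/negPn/negP=> Xlk.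
    have ltik : (i < k)%N.
      rewrite ltn_neqAle ik andbT; apply/negP=> /eqP/val_inj e.
      by rewrite -e corek ?eqxx in Xlk.
    have il : i != l by rewrite -val_eqE gtn_eqF.
    have [[_ e]|[_ e]] := spX Xik Xlk il.
      by move: (ltn_trans li ltik); rewrite e ltnn.
    by rewrite e ltnn in ltik.
  apply: half => // l lk; apply/eqP/negPn/negP=> Xil.
  have ltik : (i < k)%N.
    rewrite ltn_neqAle ik andbT; apply/negP=> /eqP/val_inj e.
    by move: Xil; rewrite sym_mxE // corek ?eqxx // e.
  have e := sparse_row XT spX ltik Xik Xil.
  by rewrite e ltnn in lk.
(* Conversely, suppose [X i j = 0] but [Y i j != 0]. Then [X *m h] is non-zero at [(i, j)], so some
   [X i k] with [k < j] is non-zero; unless this already contradicts [core], it yields a second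
   non-zero entry in row [i] of [Y], beside one right of the diagonal. *)
have [Xij0|] := eqVneq (X i j) 0; last exact: fromX.
rewrite Xij0 mulr0; apply/eqP/negPn/negP=> Yij.
have Yl0 (l : 'I_n) : (l < i)%N -> Y l j = 0.
  move=> li; apply/eqP/negPn/negP=> Ylj.
  have lj : (l < j)%N by apply: leq_trans ij.
  have [e|inj] := eqVneq i j.
    by move: Ylj; rewrite IHl // -e core // mulr0 eqxx.
  have il : i != l by rewrite -val_eqE gtn_eqF.
  have [[_ e]|[_ e]] := spY Yij Ylj il; first by rewrite e ltnn in lj.
  by rewrite e eqxx in inj.
have : (X *m h) i j != 0.
  apply: contraNneq Yij => Z0.
  by rewrite (upper_solve uh dh hXY') // Z0 mulr0.
rewrite mxE; apply/negP; rewrite negbK big1 // => k _.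
have [kj|jk] := ltnP k j; last first.
  have [/val_inj ->|kj] := eqVneq (k : nat) j; first by rewrite Xij0 mul0r.
  by rewrite uh ?mulr0 // ltn_neqAle eq_sym kj.
have [->|Xik] := eqVneq (X i k) 0; first by rewrite mul0r.
have neq_row : (i < j)%N -> Y i k != 0 -> False.
  move=> ltij Yik; have e := sparse_row YT spY ltij Yij Yik.
  by rewrite e ltnn in kj.
have above (k' : 'I_n) : (k' < i)%N -> X i k' != 0 -> (i < j)%N ->
    (k' < j)%N -> False.
  move=> ki Xik' lij k'j; have Yk'i : Y k' i != 0.
    by rewrite IHl // hh_neq0 sym_mxE.
  have e := sparse_row YT spY lij Yij (_ : Y i k' != 0).
  by rewrite e ?ltnn // sym_mxE in k'j.
exfalso; have [ki|ik|/val_inj ki] := ltngtP k i.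
- have [e|inj] := eqVneq i j.
    by move: Xik; rewrite sym_mxE // core ?eqxx.
  by apply: (above k) => //; rewrite ltn_neqAle inj.
- apply: neq_row; first exact: ltn_trans kj.
  rewrite fromX ?hh_neq0 //; first exact: ltnW.
  by move=> e; rewrite e ltnn in ik.
subst k; apply: neq_row => //.
rewrite fromX ?hh_neq0 // => _ l li; apply/eqP/negPn/negP=> Xli.
by apply: (above l) => //; [rewrite sym_mxE | exact: ltn_trans kj].
Qed.

End CongruentSparse.

(** * Diagonal entries in characteristic two *)

Section CharTwo.
Hypothesis F2 : 2%N \in [pchar F].

(** The sums over the two strict triangles agree by symmetry, hence cancel. *)
Lemma sum_sym_pchar2 (a : 'I_n -> 'I_n -> F) : (forall i j, a i j = a j i) ->
  \sum_i \sum_j a i j = \sum_i a i i.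
Proof.
move=> asym.
have split0 : \sum_(i < n) \sum_(j < n | (j < i)%N) a i j +
  \sum_(i < n) \sum_(j < n | (i < j)%N) a i j = 0.
  rewrite [X in _ + X](exchange_big_dep xpredT) //= -[RHS](addrr_pchar2 F2
    (\sum_(i < n) \sum_(j < n | (j < i)%N) a i j)).
  by congr (_ + _); apply: eq_bigr => i _; apply: eq_bigr => j _; exact: asym.
rewrite -[RHS]addr0 -[X in _ = _ + X]split0 -!big_split /=.
apply: eq_bigr => i _; rewrite (bigD1 i) //=; congr (_ + _).
rewrite (bigID (fun j : 'I_n => (j < i)%N)) /=.
congr (_ + _); apply: eq_bigl => j; rewrite -val_eqE neq_ltn.
  by case: ltngtP.
by case: ltngtP.
Qed.

Lemma congruence_diag X h i : X^T = X ->
  (h^T *m X *m h) i i = \sum_k X k k * h k i ^+ 2.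
Proof.
move=> XT; rewrite mxE.
under eq_bigr => j _ do rewrite mxE big_distrl /=.
rewrite sum_sym_pchar2; first by apply: eq_bigr => k _; rewrite mxE; ring.
by move=> j k; rewrite !mxE (sym_mxE XT j k); ring.
Qed.

(** [scaled_offpair] leaves only the diagonal entries at the ends of pairs. These follow from
    [congruence_diag] once the contributions of earlier diagonal entries are shown to vanish. *)
Lemma specialized_scaled X Y h : specialized X -> specialized Y ->
  h \in @borel F n -> h^T *m X *m h = Y ->
  forall i j, Y i j = h i i * h j j * X i j.
Proof.
move=> /specializedP[XT spX outX] /specializedP[YT spY outY] /borelP[uh dh] hXY.
have off := scaled_offpair XT YT spX spY uh dh hXY.
have scaled0 i j a : (h i i * h j j * a == 0) = (a == 0).
  by rewrite !mulf_eq0 !(negbTE (dh _)).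
have offlt (k l : 'I_n) : (k < l)%N -> Y k l = h k k * h l l * X k l.
  by move=> kl; apply: off => [|e]; [exact: ltnW | rewrite e ltnn in kl].
have hXY' : h^T *m (X *m h) = Y by rewrite mulmxA.
have pairs (a b : 'I_n) : (a < b)%N -> X a b != 0 ->
  (forall i : 'I_n, (a < i)%N -> (i < b)%N -> X i i != 0 ->
     exists2 k : 'I_n, (k < a)%N & X k i != 0) ->
  Y b b = h b b * h b b * X b b.
  move=> ab Xab inner.
  rewrite -{1}hXY congruence_diag // (bigD1 b) //= big1 ?addr0; first by ring.
  move=> i ib; have [ltib|bi] := ltnP i b; last first.
    by rewrite uh ?expr0n ?mulr0 // ltn_neqAle eq_sym ib.
  have [->|Xii] := eqVneq (X i i) 0; first by rewrite mul0r.
  (* The aim is [h i b = 0]. If row [k] of [X] is supported on column [i] alone, then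
     [(X *m h) k b = X k i * h i b], and for [k < a] the left side is zero because column [b] of [Y]
     vanishes above row [a]. *)
  suff [k ka [Xki kI]] : exists2 k : 'I_n, (k < a)%N &
      X k i != 0 /\ forall l, X k l != 0 -> l = i.
    have Z0 : (X *m h) k b = 0.
      apply/eqP; rewrite -(inj_eq (mulfI (dh k))) mulr0.
      have Y0 (l : 'I_n) : (l < a)%N -> Y l b = 0.
        move=> la; have lb := ltn_trans la ab.
        rewrite offlt //; apply/eqP; rewrite scaled0; apply/negPn/negP=> Xlb.
        have al : a != l by rewrite -val_eqE gtn_eqF.
        have [[_ e]|[_ e]] := spX _ _ _ Xab Xlb al.
          by rewrite e ltnn in lb.
        by rewrite e ltnn in ab.
      rewrite -(upper_solve uh dh hXY') ?Y0 // => l lk.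
      by rewrite Y0 //; exact: ltn_trans ka.
    move: Z0; rewrite mxE (bigD1 i) //= big1 ?addr0 => [/eqP|l li].
      by rewrite mulf_eq0 (negbTE Xki) => /eqP->; rewrite expr0n mulr0.
    have [->|/kI e] := eqVneq (X k l) 0; first by rewrite mul0r.
    by rewrite e eqxx in li.
  have pair_pivot (k : 'I_n) : (k < a)%N -> (k < i)%N -> X k i != 0 ->
      exists2 k : 'I_n, (k < a)%N & X k i != 0 /\ forall l, X k l != 0 -> l = i.
    move=> ka ki Xki; exists k => //; split=> // l Xkl.
    exact: sparse_row XT spX ki Xki Xkl.
  (* For [i > a] the row comes from [inner]. For [i < a] it is the row of an entry above [X i i], or
     row [i] itself if there is none. The case [i = a] would put two entries in row [a]. *)
  have [ai|ia|/val_inj e] := ltngtP a i.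
  - have [k ka Xki] := inner i ai ltib Xii.
    by apply: (pair_pivot k) => //; exact: ltn_trans ai.
  - have [/existsP[k /andP[ki Xki]]|noabove] :=
      boolP [exists k : 'I_n, (k < i)%N && (X k i != 0)].
      by apply: (pair_pivot k) => //; exact: ltn_trans ia.
    exists i => //; split=> // l Xil; apply/eqP/negPn/negP=> li.
    have Xli : X l i != 0 by rewrite sym_mxE.
    have [[lti _]|[]] := spX i l i Xli Xii li; last by rewrite ltnn.
    by case/negP: noabove; apply/existsP; exists l; rewrite lti.
  subst i; have e := sparse_row XT spX ab Xab Xii.
  by rewrite e eqxx in ib.
(* The inner non-zero diagonal entries are those of [X]; specializedness of [X]
   controls them when [X b b != 0], and specializedness of [Y] otherwise. *)
have diag_neq0 b : X b b != 0 -> Y b b = h b b * h b b * X b b.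
  move=> Xbb; have [/existsP[a /andP[ab Xab]]|noabove] :=
    boolP [exists a : 'I_n, (a < b)%N && (X a b != 0)].
    by apply: (pairs a) => // i ai ib Xii; exact: outX Xab Xbb Xii ai ib.
  apply: off => // _ k kb; apply/eqP/negPn/negP=> Xkb.
  by case/negP: noabove; apply/existsP; exists k; rewrite kb.
have diag b : Y b b = h b b * h b b * X b b.
  have [Xbb|] := eqVneq (X b b) 0; last exact: diag_neq0.
  have [Ybb|Ybb] := eqVneq (Y b b) 0; first by rewrite Ybb Xbb mulr0.
  have [/existsP[a /andP[ab Xab]]|noabove] :=
    boolP [exists a : 'I_n, (a < b)%N && (X a b != 0)].
    apply: (pairs a) => // i ai ib Xii.
    have Yab : Y a b != 0 by rewrite offlt ?scaled0.
    have Yii : Y i i != 0 by rewrite diag_neq0 ?scaled0.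
    have [k ka Yki] := outY a b i Yab Ybb Yii ai ib.
    by exists k => //; move: Yki; rewrite offlt ?scaled0 //; exact: ltn_trans ai.
  apply: off => // _ k kb; apply/eqP/negPn/negP=> Xkb.
  by case/negP: noabove; apply/existsP; exists k; rewrite kb.
move=> i j; have [ij|ji|/val_inj <-] := ltngtP i j; first exact: offlt.
  by rewrite (sym_mxE YT) (sym_mxE XT) offlt // mulrC [h j j * _]mulrC mulrC.
exact: diag.
Qed.

Lemma specialized_unitriangular_inj X Y : specialized X -> specialized Y ->
  congruent (@unitriangular F n) X Y -> X = Y.
Proof.
move=> sX sY [h hU hXY]; have hB := unitriangular_borel hU.
have /unitriangularP[_ h1] := hU.
by apply/matrixP=> i j; rewrite (specialized_scaled sX sY hB hXY) !h1 !mul1r.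
Qed.

(** Scaling by non-zero factors keeps the zero pattern, which determines a matrix with entries 0 and
    1. *)
Lemma specialized_borel_inj X Y : specialized X -> specialized Y ->
  zero_one_mx X -> zero_one_mx Y -> congruent (@borel F n) X Y -> X = Y.
Proof.
move=> sX sY X01 Y01 [h hB hXY]; have /borelP[_ dh] := hB.
apply/matrixP=> i j; have := specialized_scaled sX sY hB hXY i j.
have [->|->] := X01 i j; have [->|->] := Y01 i j => //.
  by rewrite mulr0 => /eqP; rewrite oner_eq0.
by rewrite mulr1 => /esym/eqP; rewrite mulf_eq0 !(negbTE (dh _)).
Qed.

End CharTwo.
End Uniqueness.

(** * Existence: row-by-row reduction by unitriangular congruences *)

Section Existence.
Variables (F : fieldType) (n : nat).
Hypothesis F2 : 2%N \in [pchar F].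
Hypothesis F_squares : forall a : F, exists b : F, b ^+ 2 = a.
Implicit Types X Y h : 'M[F]_n.

Definition free X (m : nat) (j : 'I_n) : bool :=
  (m <= j)%N && [forall i : 'I_n, (i < m)%N ==> (X i j == 0)].

Lemma freeP X m (j : 'I_n) :
  reflect ((m <= j)%N /\ forall i : 'I_n, (i < m)%N -> X i j = 0) (free X m j).
Proof.
apply: (iffP andP) => -[mj H]; split=> //.
  by move=> i im; apply/eqP; have := forallP H i; rewrite im.
by apply/forallP=> i; apply/implyP=> /H ->.
Qed.

Lemma nonfreeP X m (j : 'I_n) :
  reflect ((j < m)%N \/ exists2 i : 'I_n, (i < m)%N & X i j != 0) (~~ free X m j).
Proof.
rewrite negb_and -ltnNge negb_forall; apply: (iffP orP) => -[]; try by left.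
  by move=> /existsP[i]; rewrite negb_imply => /andP[]; right; exists i.
by case=> i im Xij; right; apply/existsP; exists i; rewrite negb_imply im.
Qed.

(* The first [m] rows are reduced; [free] indices are those not yet used by
   them, and no free index with non-zero diagonal entry lies within a pair. *)
Definition reduced X (m : nat) : Prop :=
  [/\ X^T = X, forall j, ~~ free X m j -> sparse_col X j
    & forall a b s : 'I_n, (a < m)%N -> X a b != 0 -> X b b != 0 -> X s s != 0 ->
        (a < s)%N -> (s < b)%N -> exists2 k : 'I_n, (k < a)%N & X k s != 0].

Lemma reduced0 X : X^T = X -> reduced X 0.
Proof.
by move=> XT; split=> // j /nonfreeP[|[]].
Qed.

Lemma reduced_specialized X : reduced X n -> specialized X.
Proof.
move=> [XT sp out]; apply/specializedP; split=> //.
  by move=> j; apply/sp/nonfreeP; left.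
by move=> a b s *; apply: (out a b s).
Qed.

(** This decouples used and free indices. A used column [i >= m] has an entry in a row [k < m]; a
    second one in row [j] would force [i] to be [k] or [j], and either contradicts the freeness of
    [j]. *)
Lemma free_block X m (i j : 'I_n) : reduced X m ->
  ~~ free X m i -> free X m j -> X i j = 0.
Proof.
move=> [XT sp _] nfi /freeP[mj Xj0].
have [im|[k km Xki]] := nonfreeP _ _ _ nfi; first exact: Xj0.
apply/eqP/negPn/negP=> Xij; have Xji : X j i != 0 by rewrite sym_mxE.
have kj : k != j by apply: contraTneq (leq_trans km mj) => ->; rewrite ltnn.
have [[_ e]|[_ e]] := sp i nfi k j Xki Xji kj.
  by subst j; rewrite Xj0 ?eqxx in Xki.
by subst k; rewrite Xj0 ?eqxx in Xij.
Qed.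

(** Right multiplication adds [r j] times column [p] to every column [j] at once, so a single matrix
    can clear a whole row. *)
Definition transvection (p : 'I_n) (r : 'I_n -> F) : 'M[F]_n :=
  \matrix_(i, j) ((i == j)%:R + (i == p)%:R * r j).

Lemma mul_transvection (A : 'M[F]_n) p r i j :
  (A *m transvection p r) i j = A i j + A i p * r j.
Proof.
rewrite mxE; under eq_bigr => k _ do rewrite mxE mulrDr.
rewrite big_split /=; congr (_ + _).
  rewrite (bigD1 j) //= eqxx mulr1 big1 ?addr0 // => k /negbTE->.
  by rewrite mulr0.
rewrite (bigD1 p) //= eqxx mul1r big1 ?addr0 // => k /negbTE->.
by rewrite mul0r mulr0.
Qed.

Lemma transvectionE X p r i j :
  ((transvection p r)^T *m X *m transvection p r) i j =
    X i j + r i * X p j + (X i p + r i * X p p) * r j.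
Proof.
have mulT (A : 'M[F]_n) k l : ((transvection p r)^T *m A) k l = A k l + r k * A p l.
  rewrite -[A]trmxK -trmx_mul mxE mul_transvection !mxE.
  by rewrite [_ * r k]mulrC.
by rewrite mul_transvection !mulT.
Qed.

Lemma transvection_unitriangular (p : 'I_n) r :
  (forall k : 'I_n, r k != 0 -> (p < k)%N) ->
  transvection p r \in @unitriangular F n.
Proof.
move=> pr; have r0 (k : 'I_n) : (k <= p)%N -> r k = 0.
  by move=> kp; apply: contraTeq kp => /pr; rewrite -ltnNge.
apply/unitriangularP; split=> [i j ji|i]; rewrite mxE.
  rewrite -val_eqE gtn_eqF // add0r; have [e|_] := eqVneq i p; last by rewrite mul0r.
  by rewrite r0 ?mulr0 // -e ltnW.
rewrite eqxx; have [->|_] := eqVneq i p; last by rewrite mul0r addr0.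
by rewrite r0 ?mulr0 ?addr0.
Qed.

Section ReducedTransvection.
Variables (X : 'M[F]_n) (m : nat) (p : 'I_n) (r : 'I_n -> F).
Hypotheses (redX : reduced X m) (free_p : free X m p).
Hypothesis free_r : forall k : 'I_n, r k != 0 -> (p < k)%N /\ free X m k.
Let Y := (transvection p r)^T *m X *m transvection p r.

Lemma transvection_nonfree (i j : 'I_n) : ~~ free X m j -> Y i j = X i j.
Proof.
move=> nfj; have rj : r j = 0.
  by apply/eqP; apply: contraNT nfj => /free_r[].
have [XT _ _] := redX.
rewrite transvectionE rj mulr0 addr0 (sym_mxE XT p j).
by rewrite (free_block redX nfj free_p) mulr0 addr0.
Qed.

Lemma transvection_sym : Y^T = Y.
Proof. by have [XT _ _] := redX; exact: tr_congruence. Qed.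

Lemma transvection_row (i j : 'I_n) : (i < m)%N -> Y i j = X i j.
Proof.
have [XT _ _] := redX; move=> im.
rewrite (sym_mxE transvection_sym) transvection_nonfree ?(sym_mxE XT j) //.
by apply/nonfreeP; left.
Qed.

Lemma transvection_free (j : 'I_n) : free Y m j = free X m j.
Proof.
apply/freeP/freeP=> -[mj H]; split=> // i im.
  by rewrite -transvection_row // H.
by rewrite transvection_row // H.
Qed.

(** Rows before [m] and used columns do not change, so only a new diagonal entry at a free [s]
    inside a pair [(a, b)] could do harm. As [Y s s = X s s + r s ^+ 2 * X p p] in characteristic
    two, this needs [X p p != 0]; but [a < m <= p < s < b], so the free [p] would already have
    violated the condition for [X]. *)
Lemma transvection_reduced : reduced Y m.
Proof.
have [XT sp out] := redX.
split; first exact: transvection_sym.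
  move=> j; rewrite transvection_free => nfj i k.
  by rewrite !transvection_nonfree //; exact: sp.
move=> a b s am Yab Ybb Yss as_ sb.
rewrite transvection_row // in Yab.
have nfb : ~~ free X m b by apply/nonfreeP; right; exists a.
rewrite transvection_nonfree // in Ybb.
have old (t : 'I_n) : X t t != 0 -> (a < t)%N -> (t < b)%N -> ~~ free X m t.
  move=> Xtt at_ tb; have [k ka Xkt] := out a b t am Yab Ybb Xtt at_ tb.
  by apply/nonfreeP; right; exists k => //; exact: ltn_trans am.
have [fs|nfs] := boolP (free X m s); last first.
  rewrite transvection_nonfree // in Yss.
  have [k ka Xks] := out a b s am Yab Ybb Yss as_ sb.
  by exists k; rewrite // transvection_row //; exact: ltn_trans am.
have Xss : X s s = 0.
  by apply/eqP/negPn/negP=> /old/(_ as_ sb); rewrite fs.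
have rs : r s != 0.
  by apply: contraNneq Yss => rs; rewrite transvectionE rs Xss mul0r mulr0 !addr0.
have Xpp : X p p != 0.
  apply: contraNneq Yss => Xpp; rewrite transvectionE Xss Xpp mulr0 addr0 add0r.
  by rewrite (sym_mxE XT s p) mulrC (addrr_pchar2 F2).
have [ps _] := free_r rs; have /freeP[mp _] := free_p.
by have := old p Xpp (leq_trans am mp) (ltn_trans ps sb); rewrite free_p.
Qed.

End ReducedTransvection.

(** * Reducing one more row *)

Section Step.
Variable m : 'I_n.

Lemma nonfreeS X (j : 'I_n) : ~~ free X m.+1 j ->
  [\/ ~~ free X m j, j = m | X m j != 0].
Proof.
move=> /nonfreeP[|[i]]; rewrite ltnS leq_eqVlt => /orP[/eqP/val_inj|].
- by constructor 2.
- by move=> jm; constructor 1; apply/nonfreeP; left.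
- by move=> ->; constructor 3.
by move=> im Xij; constructor 1; apply/nonfreeP; right; exists i.
Qed.

(** Column [m] already meets an earlier row, so by sparsity it has nothing below the diagonal, and
    row [m] starts no new pair. *)
Lemma reducedS_nonfree X : reduced X m -> ~~ free X m m -> reduced X m.+1.
Proof.
move=> [XT sp out] nfm.
have Xm0 (b : 'I_n) : (m < b)%N -> X m b = 0.
  move=> mb; apply/eqP/negPn/negP=> Xmb; have Xbm : X b m != 0 by rewrite sym_mxE.
  have [mm|[k km Xkm]] := nonfreeP _ _ _ nfm; first by rewrite ltnn in mm.
  have bk : b != k by rewrite -val_eqE gtn_eqF // (ltn_trans km).
  have [[bm _]|[_ e]] := sp m nfm b k Xbm Xkm bk.
    by have := ltn_trans mb bm; rewrite ltnn.
  by rewrite e ltnn in mb.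
split=> // [j /nonfreeS[|->|Xmj]|a b s]; try exact: sp.
  apply: sp; have [mj|jm|/val_inj<-//] := ltngtP m j.
    by rewrite Xm0 ?eqxx in Xmj.
  by apply/nonfreeP; left.
rewrite ltnS leq_eqVlt => /orP[/eqP/val_inj->|]; last exact: out.
move=> Xmb _ _ ms sb; move: Xmb; rewrite Xm0 ?eqxx //; exact: ltn_trans sb.
Qed.

(** Covers both a diagonal pivot whose row has been cleared and a zero row. *)
Lemma reducedS_isolated X : reduced X m ->
  (forall j, j != m -> X m j = 0) -> reduced X m.+1.
Proof.
move=> [XT sp out] Xm0.
have spm : sparse_col X m.
  move=> i k Xim Xkm ik.
  have [e|im] := eqVneq i m; last by rewrite sym_mxE // Xm0 ?eqxx in Xim.
  have [e'|km] := eqVneq k m; last by rewrite sym_mxE // Xm0 ?eqxx in Xkm.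
  by rewrite e e' eqxx in ik.
split=> // [j /nonfreeS[|->//|Xmj]|a b s]; first exact: sp.
  by have [->//|jm] := eqVneq j m; rewrite Xm0 ?eqxx in Xmj.
rewrite ltnS leq_eqVlt => /orP[/eqP/val_inj->|]; last exact: out.
move=> Xmb _ _ ms sb; have mb := ltn_trans ms sb; move: Xmb.
by rewrite Xm0 ?eqxx // -val_eqE gtn_eqF.
Qed.

(** The last hypothesis is the new instance [a = m] of the pair condition: a used [s > m] has a
    non-zero entry in some row before [m]. *)
Lemma reducedS_pair X (j : 'I_n) : reduced X m -> (m < j)%N ->
  (forall k, k != j -> X m k = 0) ->
  (forall k, k != m -> k != j -> X j k = 0) ->
  (X j j != 0 -> forall s : 'I_n, (m < s)%N -> (s < j)%N -> X s s != 0 ->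
     ~~ free X m s) ->
  reduced X m.+1.
Proof.
move=> [XT sp out] mj Xm0 Xj0 inner.
have mjN : m != j by rewrite -val_eqE ltn_eqF.
have spj : sparse_col X j.
  move=> i k Xij Xkj ik; rewrite sym_mxE // in Xij; rewrite sym_mxE // in Xkj.
  have [ei|im] := eqVneq i m.
    have [ek|km] := eqVneq k m; first by rewrite ei ek eqxx in ik.
    have [ek|kj] := eqVneq k j; last by rewrite Xj0 ?eqxx in Xkj.
    by left; rewrite ei.
  have [ei'|ij] := eqVneq i j; last by rewrite Xj0 ?eqxx in Xij.
  have [ek|km] := eqVneq k m; first by right; rewrite ek.
  have [ek|kj] := eqVneq k j; last by rewrite Xj0 ?eqxx in Xkj.
  by rewrite ei' ek eqxx in ik.
have spm : sparse_col X m.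
  move=> i k Xim Xkm ik; rewrite sym_mxE // in Xim; rewrite sym_mxE // in Xkm.
  have [ei|ij] := eqVneq i j; last by rewrite Xm0 ?eqxx in Xim.
  have [ek|kj] := eqVneq k j; last by rewrite Xm0 ?eqxx in Xkm.
  by rewrite ei ek eqxx in ik.
split=> // [k /nonfreeS[|->//|Xmk]|a b s]; first exact: sp.
  by have [->//|kj] := eqVneq k j; rewrite Xm0 ?eqxx in Xmk.
rewrite ltnS leq_eqVlt => /orP[/eqP/val_inj->|]; last exact: out.
move=> Xmb Xbb Xss ms sb; have [eb|bj] := eqVneq b j; last first.
  by rewrite Xm0 ?eqxx in Xmb.
subst b; have [sm|[k km Xks]] := nonfreeP _ _ _ (inner Xbb s ms sb Xss);
  last by exists k.
by have := ltn_trans ms sm; rewrite ltnn.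
Qed.

Local Notation congruentU := (congruent (@unitriangular F n)).

Lemma congruent_transvection X (p : 'I_n) r :
  reduced X m -> free X m p ->
  (forall k : 'I_n, r k != 0 -> (p < k)%N /\ free X m k) ->
  exists Y, [/\ congruentU X Y, reduced Y m, forall k, free Y m k = free X m k
    & forall i j, Y i j = X i j + r i * X p j + (X i p + r i * X p p) * r j].
Proof.
move=> redX fp fr; exists ((transvection p r)^T *m X *m transvection p r).
split.
- exists (transvection p r) => //; apply: transvection_unitriangular => k.
  by case/fr.
- exact: transvection_reduced.
- by move=> k; exact: transvection_free.
exact: transvectionE.
Qed.

Lemma congruent_reducedS X : reduced X m ->
  exists2 Y, congruentU X Y & reduced Y m.+1.
Proof.
have UM := @unitriangularM F n.
move=> redX; have [fm|nfm] := boolP (free X m m); last first.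
  by exists X; [exact: congruentU_refl | exact: reducedS_nonfree].
have [XT _ _] := redX; have /freeP[_ Xm] := fm.
have free_m k : X m k != 0 -> k != m -> (m < k)%N /\ free X m k.
  move=> Xmk km; have fk : free X m k.
    by apply: contraR Xmk => nfk; rewrite sym_mxE // (free_block redX nfk fm).
  by have /freeP[mk _] := fk; rewrite ltn_neqAle eq_sym km.
have [Xmm|Xmm] := eqVneq (X m m) 0; last first.
  pose r k := if k == m then 0 else - X m k / X m m.
  have [k|Y [XY redY _ YE]] := congruent_transvection redX fm (r := r).
    rewrite /r; case: (eqVneq k m) => [_|km]; first by rewrite eqxx.
    by rewrite mulf_eq0 oppr_eq0 negb_or => /andP[/free_m fk _]; exact: fk.
  exists Y => //; apply: reducedS_isolated => // j jm.
  by rewrite YE /r eqxx (negbTE jm); field.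
have [/existsP[j0 Xmj0]|/existsPn Xm0] := boolP [exists j, X m j != 0]; last first.
  exists X; first exact: congruentU_refl.
  by apply: reducedS_isolated => // j _; apply/eqP/negPn.
have [j Xmj minj] :=
  @arg_minnP _ j0 (fun j => X m j != 0) (fun j => nat_of_ord j) Xmj0.
have jm : j != m by apply: contraNneq Xmj => ->; rewrite Xmm.
have [mj fj] := free_m _ Xmj jm.
(* A free index strictly between [m] and [j] with non-zero diagonal entry,
   if any, absorbs the diagonal entry of [j]. *)
have [Y [XY redY YfE Ymk inner]] : exists Y, [/\ congruentU X Y, reduced Y m,
    forall k, free Y m k = free X m k, forall k, Y m k = X m k
  & Y j j != 0 -> forall s : 'I_n, (m < s)%N -> (s < j)%N -> Y s s != 0 ->
      ~~ free Y m s].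
  have [/existsP[s /and4P[ms sj Xss fs]]|none] := boolP [exists s : 'I_n,
      [&& (m < s)%N, (s < j)%N, X s s != 0 & free X m s]]; last first.
    exists X; split=> //; first exact: congruentU_refl.
    move=> _ s ms sj Xss; apply: contraNN none => fs.
    by apply/existsP; exists s; rewrite ms sj Xss.
  (* Adding [c] times column [s] turns [X j j] into [X j j + c ^+ 2 * X s s], the cross terms
     cancelling; this choice of [c] makes it zero. Row [m] is unaffected, since [X m s = 0] by
     minimality of [j]. *)
  have [c cE] := F_squares (X j j / X s s).
  pose r k := if k == j then c else 0.
  have [k|Y [XY redY YfE YE]] := congruent_transvection redX fs (r := r).
    by rewrite /r; case: (eqVneq k j) => [->|]; rewrite ?eqxx.
  exists Y; split=> //.
    have Xms : X m s = 0 by apply: contraTeq sj => /minj; rewrite -leqNgt.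
    by move=> k; rewrite YE /r eq_sym (negbTE jm) mul0r Xms mul0r !addr0 mul0r addr0.
  rewrite YE /r eqxx (sym_mxE XT s j).
  have -> : X j j + c * X j s + (X j s + c * X s s) * c =
    X j j + c ^+ 2 * X s s + (c * X j s + c * X j s) by ring.
  by rewrite cE divfK // !(addrr_pchar2 F2) eqxx.
(* Column [j] clears row [m] to its right; the entries before [j] vanish by minimality. *)
pose r (k : 'I_n) := if (j < k)%N then - Y m k / Y m j else 0.
have Ymj : Y m j != 0 by rewrite Ymk.
have [|k|Z [YZ redZ ZfE ZE]] := congruent_transvection redY (p := j) (r := r).
- by rewrite YfE.
- rewrite /r; case: ifP => [jk|]; last by rewrite eqxx.
  rewrite mulf_eq0 oppr_eq0 negb_or YfE Ymk => /andP[/free_m fk _].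
  split=> //; apply: (proj2 (fk _)).
  by rewrite -val_eqE gtn_eqF // (ltn_trans mj).
have rm : r m = 0 by rewrite /r ltnNge ltnW.
have rj : r j = 0 by rewrite /r ltnn.
have Zmj : Z m j != 0 by rewrite ZE rm rj mul0r mulr0 !addr0.
have Zm0 k : k != j -> Z m k = 0.
  rewrite neq_ltn => /orP[kj|jk]; last first.
    by rewrite ZE rm /r jk; field.
  rewrite ZE rm /r ltnNge (ltnW kj) /= mulr0 mul0r !addr0 Ymk.
  by apply: contraTeq kj => /minj; rewrite -leqNgt.
have [ZT _ _] := redZ.
have fmZ : free Z m m by rewrite ZfE YfE.
have fjZ : free Z m j by rewrite ZfE YfE.
(* Column [m] clears row [j] without disturbing row [m], because [Z m m = 0]. The entry [(j, j)] is
   left alone: in characteristic two column [m] cannot change it. *)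
pose r' k := if (k == m) || (k == j) then 0 else - Z j k / Z m j.
have [k|W [ZW redW WfE WE]] := congruent_transvection redZ fmZ (r := r').
  rewrite /r'; case: ifP => [|/norP[km kj]]; first by rewrite eqxx.
  rewrite mulf_eq0 oppr_eq0 negb_or => /andP[Zjk _].
  have fk : free Z m k.
    by apply: contraR Zjk => nfk; rewrite sym_mxE // (free_block redZ nfk fjZ).
  by have /freeP[mk _] := fk; rewrite ltn_neqAle eq_sym km.
have Zmm : Z m m = 0 by apply: Zm0; rewrite eq_sym.
have r'm : r' m = 0 by rewrite /r' eqxx.
have r'j : r' j = 0 by rewrite /r' eqxx orbT.
exists W.
  by apply: (congruent_trans UM XY); apply: (congruent_trans UM YZ).
apply: (@reducedS_pair W j) => //.
- by move=> k kj; rewrite WE r'm Zmm mul0r mulr0 !addr0 mul0r addr0 Zm0.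
- move=> k km kj; rewrite WE r'j mul0r Zmm mulr0 !addr0 (sym_mxE ZT j m).
  by rewrite /r' (negbTE km) (negbTE kj) /=; field.
(* The second clearing changes no diagonal entry in characteristic two, and the first only those
   beyond [j], so [inner] passes from [Y] to [W]. *)
have diagE (s : 'I_n) : (s <= j)%N -> W s s = Y s s.
  move=> sj; rewrite WE Zmm mulr0 addr0 (sym_mxE ZT s m) mulrC -addrA.
  rewrite (addrr_pchar2 F2) addr0 ZE.
  by rewrite /r ltnNge sj /= mul0r mulr0 !addr0.
move=> Wjj s ms sj; rewrite diagE ?(ltnW sj) // WfE ZfE.
by apply: inner => //; rewrite -diagE.
Qed.

End Step.

Lemma congruent_specialized X : X^T = X ->
  exists2 Y, congruent (@unitriangular F n) X Y & specialized Y.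
Proof.
move=> XT; suff H m : (m <= n)%N ->
    exists2 Y, congruent (@unitriangular F n) X Y & reduced Y m.
  by have [Y XY /reduced_specialized] := H n (leqnn n); exists Y.
elim: m => [_|m IH mn].
  by exists X; [exact: congruentU_refl | exact: reduced0].
have [Y XY redY] := IH (ltnW mn).
have [Z YZ redZ] := congruent_reducedS (m := Ordinal mn) redY.
by exists Z => //; apply: congruent_trans XY YZ; exact: unitriangularM.
Qed.

End Existence.

(** * Normalizing the entries to 0 and 1 by a diagonal scaling *)

Section ZeroOne.
Variables (F : fieldType) (n : nat).
Hypothesis F_squares : forall a : F, exists b : F, b ^+ 2 = a.
Implicit Types X Y : 'M[F]_n.

Lemma specialized_support X Y :
  (forall i j, (Y i j == 0) = (X i j == 0)) -> Y^T = Y ->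
  specialized X -> specialized Y.
Proof.
move=> E YT /specializedP[XT sp out]; apply/specializedP; split=> //.
  by move=> j i k; rewrite !E; exact: sp.
move=> a b s; rewrite !E => Xab Xbb Xss as_ sb.
by have [k ka Xks] := out a b s Xab Xbb Xss as_ sb; exists k; rewrite ?E.
Qed.

Lemma specialized_zero_one X : specialized X ->
  exists Y, [/\ specialized Y, zero_one_mx Y & congruent (@borel F n) X Y].
Proof.
move=> sX; have [XT sp _] := (specializedP X).1 sX.
(* [c j] is a square root of the inverse diagonal entry, or 1 where that entry is zero. *)
have [c cP] : exists c : 'I_n -> F, forall j, c j != 0 /\
    (c j * X j j * c j = 0 \/ c j * X j j * c j = 1).
  apply: (@fin_all_exists _ (fun=> F) (fun j a => a != 0 /\
    (a * X j j * a = 0 \/ a * X j j * a = 1))) => j.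
  have [Xjj|Xjj] := eqVneq (X j j) 0.
    by exists 1; rewrite oner_neq0 Xjj mulr0 mul0r; split=> //; left.
  have [b b2] := F_squares (X j j)^-1; exists b; split.
    by have := invr_neq0 Xjj; rewrite -b2 expf_eq0.
  by right; rewrite mulrAC -expr2 b2 mulVf.
(* An index with an entry to the right of the diagonal has zero diagonal entry by [sparse_row], so
   its factor is free to normalize that off-diagonal entry. All other indices keep [c j]. *)
pose d (j : 'I_n) := if [pick k : 'I_n | (j < k)%N && (X j k != 0)] is Some k
  then (c k * X j k)^-1 else c j.
have d_fst (i j : 'I_n) : (i < j)%N -> X i j != 0 -> d i = (c j * X i j)^-1.
  move=> ij Xij; rewrite /d; case: pickP => [k /andP[ik Xik]|/(_ j)].
    by rewrite (sparse_row XT sp ij Xij Xik).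
  by rewrite ij Xij.
have d_snd (i j : 'I_n) : (i <= j)%N -> X i j != 0 -> d j = c j.
  move=> ij Xij; rewrite /d; case: pickP => [k /andP[jk Xjk]|//].
  have e : i = k by apply: (sparse_row XT sp jk Xjk); rewrite sym_mxE.
  by move: (leq_ltn_trans ij jk); rewrite e ltnn.
have d0 j : d j != 0.
  rewrite /d; case: pickP => [k /andP[_ Xjk]|_]; last by case: (cP j).
  by rewrite invr_eq0 mulf_neq0 //; case: (cP k).
pose D := diag_mx (\row_j d j); pose Y := D^T *m X *m D.
have YE i j : Y i j = d i * X i j * d j.
  by rewrite /Y /D tr_diag_mx mul_mx_diag mul_diag_mx !mxE.
have YT : Y^T = Y by exact: tr_congruence.
exists Y; split.
- apply: specialized_support sX => // i j.
  by rewrite YE !mulf_eq0 !(negbTE (d0 _)) orbF.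
- have lt01 (i j : 'I_n) : (i < j)%N -> Y i j = 0 \/ Y i j = 1.
    move=> ij; have [e|Xij] := eqVneq (X i j) 0.
      by left; rewrite YE e mulr0 mul0r.
    right; rewrite YE (d_fst i j) // (d_snd i j) ?(ltnW ij) //.
    by have [cj _] := cP j; field; rewrite Xij.
  move=> i j; have [ij|ji|/val_inj<-] := ltngtP i j; first exact: lt01.
    by rewrite (sym_mxE YT); exact: lt01.
  have [e|Xii] := eqVneq (X i i) 0; first by left; rewrite YE e mulr0 mul0r.
  by rewrite YE (d_snd i i) //; case: (cP i).
exists D => //; apply/borelP; split=> [i j ji|i]; rewrite !mxE ?eqxx ?mulr1n //.
by rewrite -val_eqE gtn_eqF.
Qed.

End ZeroOne.

Theorem theorem4p1 (F : fieldType) (F_char2 : 2%N \in [pchar F])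
    (F_squares : forall a : F, exists b : F, b ^+ 2 = a)
    (n : nat) (n_ge2 : (2 <= n)%N)
    (X : 'M[F]_n) (X_sym : X^T = X) :
  (exists! Y : 'M[F]_n,
     specialized Y /\ congruent (@unitriangular F n) X Y) /\
  (exists! Y : 'M[F]_n,
     [/\ specialized Y, zero_one_mx Y & congruent (@borel F n) X Y]).
Proof.
have unitB (h : 'M[F]_n) : h \in @borel F n -> h \in unitmx by case/andP.
have [Y XY sY] := congruent_specialized F_char2 F_squares X_sym.
split.
  exists Y; split=> // Z [sZ XZ]; apply: (specialized_unitriangular_inj F_char2) => //.
  apply: (congruent_trans (@unitriangularM F n) _ XZ).
  apply: congruent_sym XY => h; last exact: unitriangularV.
  by move/unitriangular_borel/unitB.
have [Z [sZ Z01 YZ]] := specialized_zero_one F_squares sY.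
have XZ : congruent (@borel F n) X Z.
  apply: (congruent_trans (@borelM F n) _ YZ).
  by have [h hU hXY] := XY; exists h => //; exact: unitriangular_borel.
exists Z; split=> // W [sW W01 XW]; apply: (specialized_borel_inj F_char2) => //.
apply: (congruent_trans (@borelM F n) _ XW).
by apply: congruent_sym XZ => h; [exact: unitB | exact: borelV].
Qed.
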